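(* Let $p$ be a prime, $d\ge 1$, and $\delta>0$. Let $(\Lambda_n)_{n\in\mathbb{N}}$ be a sequence of uniformly discrete subsets of $\mathbb{Q}_p^d$ with separation constants $\delta(\Lambda_n)\ge\delta$ for all $n$, and suppose that $\Lambda_n$ converges weakly to a set $\Lambda\subset\mathbb{Q}_p^d$. If $f\in L^1(\mathbb{Q}_p^d)$ is non-negative and $(f,\Lambda_n)$ is a tiling pair for all $n\in\mathbb{N}$, then $(f,\Lambda)$ is also a tiling pair.
   Context: $\mathbb{Q}_p^d$ carries the norm $|x|_p=\max_{1\le j\le d}|x_j|_p$ and the Haar measure $dx$ normalized so that $\mathbb{Z}_p^d$ has measure $1$. A set $\Lambda\subset\mathbb{Q}_p^d$ is uniformly discrete if there is $\delta>0$ with $|\lambda-\lambda'|_p\ge\delta$ for any two distinct $\lambda,\lambda'\in\Lambda$; the largest such $\delta$ is the separation constant $\delta(\Lambda)$. So $\delta(\Lambda_n)\ge\delta$ means that any two distinct points of $\Lambda_n$ are at distance at least $\delta$. For $\gamma\in\mathbb{Z}$, $B_\gamma^d$ denotes the open ball of radius $p^\gamma$ centered at the origin of $\mathbb{Q}_p^d$. Weak convergence: a sequence $\Lambda_n$ of uniformly discrete sets with $\delta(\Lambda_n)\ge\delta>0$ converges weakly to $\Lambda$ if for every $\eta\in\mathbb{N}$ and every $\gamma\in\mathbb{Z}$ there exists $N$ such that for all $n\ge N$, $\Lambda_n\cap B_\gamma^d\subset\Lambda+B_{-\eta}^d$ and $\Lambda\cap B_\gamma^d\subset\Lambda_n+B_{-\eta}^d$.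 Tiling pair (functions): for a non-negative $f\in L^1(\mathbb{Q}_p^d)$ and a discrete set $\Lambda\subset\mathbb{Q}_p^d$, $(f,\Lambda)$ is a tiling pair if $\sum_{\lambda\in\Lambda}f(x-\lambda)=1$ for a.e. $x\in\mathbb{Q}_p^d$. *)

(* Defs.v *)
From HB Require Import structures.
From mathcomp Require Import all_boot all_order all_algebra.
From mathcomp Require Import generic_quotient ring_quotient.
From mathcomp Require Import all_classical all_reals all_analysis.

Set Implicit Arguments.
Unset Strict Implicit.
Unset Printing Implicit Defensive.

Import Order.TTheory GRing.Theory Num.Theory.

Local Open Scope classical_set_scope.
Local Open Scope ring_scope.
Local Open Scope quotient_scope.

(* Nothing below asks p to be prime.  Since logn p vanishes for p not prime,
   rat_padic_abs p is then the trivial absolute value on rat. *)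

Definition rat_padic_val (p : nat) (q : rat) : int :=
  (logn p `|numq q|)%:Z - (logn p `|denq q|)%:Z.

Definition rat_padic_abs (p : nat) (q : rat) : rat :=
  if q == 0 then 0 else p%:R ^ (- rat_padic_val p q).

Section RatPadicAbs.
Variable p : nat.
Local Notation v := (rat_padic_val p).
Local Notation N := (rat_padic_abs p).

Lemma rat_padic_valE (a b : int) : a != 0 -> b != 0 ->
  v (a%:~R / b%:~R) = (logn p `|a|)%:Z - (logn p `|b|)%:Z.
Proof.
move=> a0 b0; set q := a%:~R / b%:~R.
have q0 : q != 0 by rewrite mulf_neq0 ?invr_eq0 ?intr_eq0.
have E : (`|a| * `|denq q| = `|numq q| * `|b|)%N.
  rewrite -!abszM; congr (absz _); apply: (@intr_inj rat).
  rewrite !rmorphM /=; apply/eqP.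
  by rewrite -eqr_div ?intr_eq0 ?denq_neq0// divq_num_den.
have := congr1 (logn p) E.
rewrite !lognM ?absz_gt0 ?denq_neq0 ?numq_eq0// => {}E.
by rewrite /rat_padic_val; apply/eqP; rewrite subr_eq addrAC eq_sym subr_eq
  -!PoszD E.
Qed.

Lemma rat_padic_valM x y : x != 0 -> y != 0 -> v (x * y) = v x + v y.
Proof.
move=> x0 y0; rewrite -{1}(divq_num_den x) -{1}(divq_num_den y).
rewrite mulrACA -invfM -!rmorphM /=.
rewrite rat_padic_valE ?mulf_neq0 ?numq_eq0 ?denq_neq0//.
rewrite !abszM !lognM ?absz_gt0 ?numq_eq0 ?denq_neq0//.
by rewrite !PoszD opprD addrACA.
Qed.

Lemma rat_padic_abs0 : N 0 = 0. Proof. by rewrite /rat_padic_abs eqxx. Qed.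

Lemma rat_padic_base_neq0 : prime p -> p%:R != 0 :> rat.
Proof. by move=> /prime_gt0; rewrite pnatr_eq0 lt0n. Qed.

Lemma rat_padic_val_nprime x : ~~ prime p -> v x = 0.
Proof. by move=> /negPf np; rewrite /rat_padic_val /logn np. Qed.

Lemma rat_padic_abs_gt0 x : x != 0 -> 0 < N x.
Proof.
move=> x0; rewrite /rat_padic_abs (negPf x0).
have [pp|np] := boolP (prime p); last by rewrite rat_padic_val_nprime.
by rewrite exprz_gt0// ltr0n prime_gt0.
Qed.

Lemma rat_padic_abs_ge0 x : 0 <= N x.
Proof.
by have [->|/rat_padic_abs_gt0/ltW//] := eqVneq x 0; rewrite rat_padic_abs0.
Qed.

Lemma rat_padic_absM x y : N (x * y) = N x * N y.
Proof.
have [->|x0] := eqVneq x 0; first by rewrite mul0r rat_padic_abs0 mul0r.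
have [->|y0] := eqVneq y 0; first by rewrite mulr0 rat_padic_abs0 mulr0.
rewrite /rat_padic_abs mulf_eq0 (negPf x0) (negPf y0) /=.
have [pp|np] := boolP (prime p); last by rewrite !rat_padic_val_nprime.
by rewrite rat_padic_valM// opprD expfzDr// rat_padic_base_neq0.
Qed.

Lemma rat_padic_abs1 : N 1 = 1.
Proof.
have : N 1 * N 1 = N 1 * 1 by rewrite -rat_padic_absM !mulr1.
by apply: mulfI; rewrite gt_eqF// rat_padic_abs_gt0.
Qed.

Lemma rat_padic_absN x : N (- x) = N x.
Proof. by rewrite /rat_padic_abs /rat_padic_val oppr_eq0 numqN denqN abszN. Qed.

Lemma rat_padic_absB x y : N (x - y) = N (y - x).
Proof. by rewrite -rat_padic_absN opprB. Qed.

Lemma rat_padic_absD x y : N (x + y) <= Num.max (N x) (N y).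
Proof.
wlog vxy : x y / v x <= v y.
  move=> W; have [|/ltW] := leP (v x) (v y); first exact: W.
  by move=> /W; rewrite addrC maxC.
have [->|x0] := eqVneq x 0; first by rewrite add0r le_max lexx orbT.
have [->|y0] := eqVneq y 0; first by rewrite addr0 le_max lexx.
have [->|s0] := eqVneq (x + y) 0.
  by rewrite rat_padic_abs0 le_max rat_padic_abs_ge0.
rewrite le_max; apply/orP; left.
rewrite /rat_padic_abs (negPf x0) (negPf s0).
have [pp|np] := boolP (prime p); last by rewrite !rat_padic_val_nprime.
rewrite ler_eXz2l ?ltr1n ?prime_gt1// lerN2.
have dx0 := denq_neq0 x; have dy0 := denq_neq0 y.
pose a := numq x * denq y; pose b := numq y * denq x.
have sE : x + y = (a + b)%:~R / (denq x * denq y)%:~R.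
  rewrite -{1}(divq_num_den x) -{1}(divq_num_den y).
  by rewrite addf_div ?intr_eq0// rmorphD !rmorphM.
have ab0 : a + b != 0.
  by apply: contra_neq s0 => ab; rewrite sE ab mul0r.
have xE : v x = (logn p `|a|)%:Z - (logn p `|denq x * denq y|)%:Z.
  rewrite -rat_padic_valE ?mulf_neq0 ?numq_eq0//.
  by rewrite !rmorphM /= -mulf_div divff ?intr_eq0// mulr1 divq_num_den.
have yE : v y = (logn p `|b|)%:Z - (logn p `|denq x * denq y|)%:Z.
  rewrite -rat_padic_valE ?mulf_neq0 ?numq_eq0//.
  rewrite !rmorphM /= [X in _ / X]mulrC -mulf_div.
  by rewrite divff ?intr_eq0// mulr1 divq_num_den.
rewrite sE rat_padic_valE ?mulf_neq0// xE lerD2r lez_nat.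
rewrite -pfactor_dvdn ?absz_gt0//.
set k := logn p _; have zE (c : int) : (p ^ k %| `|c|)%N = ((p ^ k)%:Z %| c)%Z.
  by rewrite dvdzE.
rewrite zE rpredD// -zE pfactor_dvdn ?absz_gt0 ?mulf_neq0 ?numq_eq0//.
by move: vxy; rewrite xE yE lerD2r lez_nat.
Qed.

Lemma rat_padic_abs_isosceles x y : N (x - y) < N x -> N y = N x.
Proof.
move=> h; apply/eqP; rewrite eq_le; apply/andP; split.
  have := rat_padic_absD x (y - x); rewrite addrC subrK.
  by move/le_trans; apply; rewrite ge_max lexx rat_padic_absB ltW.
have := rat_padic_absD (x - y) y; rewrite subrK le_max => /orP[|//].
by rewrite leNgt h.
Qed.

End RatPadicAbs.

Section CauchySequences.
Variable p : nat.
Local Notation N := (rat_padic_abs p).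

Definition padic_cauchy : pred (nat -> rat) := fun u =>
  `[< forall e : rat, 0 < e -> exists n0, forall m n,
        (n0 <= m)%N -> (n0 <= n)%N -> N (u m - u n) < e >].

Lemma padic_cauchy_bounded u : u \in padic_cauchy ->
  exists2 M, 0 < M & exists n0, forall n, (n0 <= n)%N -> N (u n) <= M.
Proof.
move=> /asboolP /(_ 1 ltr01) [n0 h].
exists (Num.max 1 (N (u n0))); first by rewrite lt_max ltr01.
exists n0 => n nn0; rewrite -[u n](subrK (u n0)).
apply: (le_trans (rat_padic_absD p _ _)).
by rewrite ge_max !le_max lexx orbT andbT ltW ?h.
Qed.

Lemma padic_cauchy_subring_closed : subring_closed padic_cauchy.
Proof.
split.
- by apply/asboolP => e e0; exists 0 => m n _ _; rewrite subrr rat_padic_abs0.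
- move=> u w /asboolP hu /asboolP hw; apply/asboolP => e e0.
  have [n1 h1] := hu e e0; have [n2 h2] := hw e e0.
  exists (maxn n1 n2) => m n; rewrite !geq_max => /andP[m1 m2] /andP[k1 k2].
  have -> : (u - w) m - (u - w) n = (u m - u n) + - (w m - w n).
    by rewrite /= !opprD addrACA.
  apply: (le_lt_trans (rat_padic_absD p _ _)).
  by rewrite gt_max rat_padic_absN h1 ?h2.
- move=> u w hu hw; apply/asboolP => e e0.
  have [A A0 [a hA]] := padic_cauchy_bounded hu.
  have [B B0 [b hB]] := padic_cauchy_bounded hw.
  have [n1 h1] := asboolP _ hu _ (divr_gt0 e0 B0).
  have [n2 h2] := asboolP _ hw _ (divr_gt0 e0 A0).
  exists (maxn (maxn a b) (maxn n1 n2)) => m n.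
  rewrite !geq_max => /andP[/andP[ma mb] /andP[m1 m2]].
  move=> /andP[/andP[na nb] /andP[k1 k2]].
  have -> : (u * w) m - (u * w) n = u m * (w m - w n) + (u m - u n) * w n.
    by rewrite mulrBr mulrBl addrA subrK.
  apply: (le_lt_trans (rat_padic_absD p _ _)).
  rewrite gt_max !rat_padic_absM; apply/andP; split.
    apply: (le_lt_trans (ler_wpM2r (rat_padic_abs_ge0 p _) (hA _ ma))).
    by rewrite mulrC -ltr_pdivlMr// h2.
  apply: (le_lt_trans (ler_wpM2l (rat_padic_abs_ge0 p _) (hB _ nb))).
  by rewrite -ltr_pdivlMr// h1.
Qed.

HB.instance Definition _ :=
  GRing.isSubringClosed.Build (nat -> rat) padic_cauchy
    padic_cauchy_subring_closed.

Record cauchy_seq := CauchySeq {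
  cauchy_val :> nat -> rat;
  _ : cauchy_val \in padic_cauchy }.

HB.instance Definition _ := [isSub for cauchy_val].
HB.instance Definition _ := [Choice of cauchy_seq by <:].
HB.instance Definition _ := [SubChoice_isSubComNzRing of cauchy_seq by <:].

Definition padic_null : pred cauchy_seq := fun u =>
  `[< forall e : rat, 0 < e -> exists n0, forall n,
        (n0 <= n)%N -> N (u n) < e >].

Lemma padic_null_idealr_closed : idealr_closed padic_null.
Proof.
split.
- by apply/asboolP => e e0; exists 0 => n _; rewrite rat_padic_abs0.
- apply/negP => /asboolP /(_ 1 ltr01) [n0 /(_ n0 (leqnn _))].
  by rewrite rat_padic_abs1 ltxx.
- move=> a u w /asboolP hu /asboolP hw; apply/asboolP => e e0.
  have [A A0 [n0 hA]] := padic_cauchy_bounded (valP a).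
  have [n1 h1] := hu _ (divr_gt0 e0 A0); have [n2 h2] := hw _ e0.
  exists (maxn n0 (maxn n1 n2)) => n; rewrite !geq_max => /and3P[k0 k1 k2].
  apply: (le_lt_trans (rat_padic_absD p (a n * u n) (w n))).
  rewrite gt_max h2// andbT rat_padic_absM.
  apply: (le_lt_trans (ler_wpM2r (rat_padic_abs_ge0 p _) (hA _ k0))).
  by rewrite mulrC -ltr_pdivlMr// h1.
Qed.

HB.instance Definition _ :=
  isIdealr.Build cauchy_seq padic_null padic_null_idealr_closed.

Definition padic_null_ideal : idealr cauchy_seq := padic_null.

Lemma padic_cauchy_eventually (u : cauchy_seq) : u \notin padic_null ->
  exists2 c, 0 < c & exists n0, forall n, (n0 <= n)%N -> N (u n) = c.
Proof.
move=> /asboolP; rewrite -existsNE => -[e]; rewrite not_implyE => -[e0].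
rewrite -forallNE => h.
have [n0 hc] := asboolP _ (valP u) e e0.
have [n nn0 en] : exists2 n, (n0 <= n)%N & e <= N (u n).
  have := h n0; rewrite -existsNE => -[n]; rewrite not_implyE => -[nn0].
  by move=> /negP; rewrite -leNgt; exists n.
exists (N (u n)); first exact: lt_le_trans en.
exists n0 => m mn0; apply: rat_padic_abs_isosceles.
by apply: lt_le_trans en; exact: hc.
Qed.

Definition padic_inv_fun (u : cauchy_seq) : nat -> rat :=
  if u \in padic_null then fun=> 0 else fun n => (u n)^-1.

Lemma padic_inv_fun_cauchy u : padic_inv_fun u \in padic_cauchy.
Proof.
rewrite /padic_inv_fun; case: ifPn => [_|/padic_cauchy_eventually].
  by apply/asboolP => e e0; exists 0 => m n _ _; rewrite subrr rat_padic_abs0.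
move=> [c c0 [n0 hc]]; apply/asboolP => e e0.
have [n1 h1] := asboolP _ (valP u) _ (mulr_gt0 e0 (mulr_gt0 c0 c0)).
have nz n : (n0 <= n)%N -> u n != 0.
  move=> /hc; apply: contra_eq_neq => ->.
  by rewrite rat_padic_abs0 lt_eqF.
exists (maxn n0 n1) => m n; rewrite !geq_max => /andP[m0 m1] /andP[k0 k1].
have E : u n - u m = ((u m)^-1 - (u n)^-1) * (u m * u n).
  by rewrite mulrBl mulrA mulVf ?nz// mul1r mulrCA mulVf ?nz// mulr1.
have := h1 _ _ k1 m1; rewrite E !rat_padic_absM !hc//.
by rewrite ltr_pM2r ?mulr_gt0.
Qed.

End CauchySequences.

Arguments padic_null : clear implicits.

(* The completion of rat for the p-adic absolute value. *)
Definition padic (p : nat) : Type := {ideal_quot padic_null_ideal p}.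

HB.instance Definition _ (p : nat) :=
  GRing.ComNzRing.copy (padic p) {ideal_quot padic_null_ideal p}.
HB.instance Definition _ (p : nat) :=
  isPointed.Build (padic p) 0.

(* The limit of the absolute values of any Cauchy sequence representing x
   (padic_abs_pi); it lies in rat because these are eventually constant or
   tend to 0. *)
Definition padic_abs (p : nat) (x : padic p) : rat :=
  xget 0 [set r | forall e : rat, 0 < e -> exists n0, forall n,
    (n0 <= n)%N ->
    `|rat_padic_abs p ((repr (x : {ideal_quot padic_null_ideal p}) : cauchy_seq p) n)
      - r| < e].

Section PadicField.
Variable p : nat.
Local Notation Q := {ideal_quot padic_null_ideal p}.
Local Notation N := (rat_padic_abs p).

Definition padic_of_seq (u : cauchy_seq p) : padic p := \pi_Q u.

Definition padic_seq (x : padic p) : cauchy_seq p := repr (x : Q).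

Lemma padic_seqK x : padic_of_seq (padic_seq x) = x.
Proof. exact: reprK. Qed.

Lemma padic_of_seqP u w :
  reflect (padic_of_seq u = padic_of_seq w) (u - w \in padic_null p).
Proof. by rewrite Quotient.idealrBE; exact: eqP. Qed.

Lemma padic_of_seq0 u : (padic_of_seq u == 0) = (u \in padic_null p).
Proof.
have -> : 0 = padic_of_seq 0 by exact: (esym (rmorph0 \pi_Q)).
by rewrite -[X in X \in _]subr0; apply/eqP/idP => /padic_of_seqP.
Qed.

Lemma padic_of_seqD u w :
  padic_of_seq (u + w) = padic_of_seq u + padic_of_seq w.
Proof. exact: (rmorphD \pi_Q). Qed.

Lemma padic_of_seqN u : padic_of_seq (- u) = - padic_of_seq u.
Proof. exact: (rmorphN \pi_Q). Qed.

Lemma padic_of_seqM u w :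
  padic_of_seq (u * w) = padic_of_seq u * padic_of_seq w.
Proof. exact: (rmorphM \pi_Q). Qed.

Lemma padic_of_seq1 : padic_of_seq 1 = 1.
Proof. exact: (rmorph1 \pi_Q). Qed.

Definition padic_inv (x : padic p) : padic p :=
  padic_of_seq (CauchySeq (padic_inv_fun_cauchy (padic_seq x))).

Lemma padic_mulVf (x : padic p) : x != 0 -> padic_inv x * x = 1.
Proof.
move=> x0; rewrite -{2}(padic_seqK x) -padic_of_seqM -padic_of_seq1.
apply/padic_of_seqP/asboolP => e e0.
move: x0; rewrite -{1}(padic_seqK x) padic_of_seq0 => x0.
have [c c0 [n0 hc]] := padic_cauchy_eventually x0.
exists n0 => n nn0 /=; rewrite /padic_inv_fun (negPf x0).
have un0 : padic_seq x n != 0.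
  by move: (hc _ nn0); apply: contra_eq_neq => ->; rewrite rat_padic_abs0 lt_eqF.
have -> : (((fun n => (padic_seq x n)^-1) * (padic_seq x : nat -> rat))%R
   - (1 : nat -> rat)) n = (padic_seq x n)^-1 * padic_seq x n - 1 by [].
by rewrite mulVf// subrr rat_padic_abs0.
Qed.

Lemma padic_invr0 : padic_inv 0 = 0.
Proof.
apply/eqP; rewrite padic_of_seq0; apply/asboolP => e e0; exists 0 => n _ /=.
by rewrite /padic_inv_fun -padic_of_seq0 padic_seqK eqxx rat_padic_abs0.
Qed.

HB.instance Definition _ :=
  GRing.ComNzRing_isField.Build (padic p) padic_mulVf padic_invr0.

Lemma padic_abs_pi (u : cauchy_seq p) (r : rat) :
  (forall e : rat, 0 < e -> exists n0, forall n,
    (n0 <= n)%N -> `|N (u n) - r| < e) ->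
  padic_abs (padic_of_seq u) = r.
Proof.
move=> ur; set x := padic_of_seq u.
have /asboolP xu : padic_seq x - u \in padic_null p.
  by apply/padic_of_seqP; rewrite padic_seqK.
have dN a b : `|N a - N b| <= N (a - b).
  wlog ba : a b / N b <= N a.
    move=> W; have [|/ltW] := leP (N b) (N a); first exact: W.
    by move=> /W; rewrite distrC rat_padic_absB.
  rewrite ger0_norm ?subr_ge0//; have [h|h] := ltP (N (a - b)) (N a).
    by rewrite (rat_padic_abs_isosceles h) subrr rat_padic_abs_ge0.
  by apply: le_trans h; rewrite gerBl rat_padic_abs_ge0.
have xr (e : rat) : 0 < e -> exists n0, forall n, (n0 <= n)%N ->
    `|N (padic_seq x n) - r| < e.
  move=> e0; have e20 : 0 < e / 2 by rewrite divr_gt0.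
  have [n1 h1] := ur _ e20; have [n2 h2] := xu _ e20.
  exists (maxn n1 n2) => n; rewrite geq_max => /andP[k1 k2].
  rewrite -(subrKA (N (u n))) (splitr e); apply: (le_lt_trans (ler_normD _ _)).
  by apply: ltrD; [exact: le_lt_trans (dN _ _) (h2 _ k2)|exact: h1].
apply: xget_unique => // s xs; apply/eqP; rewrite -subr_eq0 -normr_le0.
rewrite leNgt; apply/negP => /[dup] rs0.
have e20 : 0 < `|s - r| / 2 by rewrite divr_gt0.
have [n1 h1] := xr _ e20; have [n2 h2] := xs _ e20.
have := ltrD (h2 (maxn n1 n2) (leq_maxr _ _)) (h1 (maxn n1 n2) (leq_maxl _ _)).
rewrite -splitr distrC => /(le_lt_trans (ler_normD _ _)).
by rewrite subrKA ltxx.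
Qed.

Lemma padic_abs0 : padic_abs (0 : padic p) = 0.
Proof.
rewrite -[0](padic_seqK 0); apply: padic_abs_pi => e e0.
have /asboolP /(_ e e0) [n0 h] : padic_seq 0 \in padic_null p.
  by rewrite -padic_of_seq0 padic_seqK.
by exists n0 => n /h; rewrite subr0 ger0_norm ?rat_padic_abs_ge0.
Qed.

Lemma padic_abs_eventually u : padic_of_seq u != 0 ->
  exists n0, forall n, (n0 <= n)%N -> N (u n) = padic_abs (padic_of_seq u).
Proof.
rewrite padic_of_seq0 => /padic_cauchy_eventually[c c0 [n0 hc]].
rewrite (@padic_abs_pi _ c); first by exists n0.
by move=> e e0; exists n0 => n /hc ->; rewrite subrr normr0.
Qed.

Lemma padic_abs_gt0 (x : padic p) : x != 0 -> 0 < padic_abs x.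
Proof.
rewrite -{1}(padic_seqK x) padic_of_seq0 => /padic_cauchy_eventually[c c0].
move=> [n0 hc]; rewrite -(padic_seqK x) (@padic_abs_pi _ c)// => e e0.
by exists n0 => n /hc ->; rewrite subrr normr0.
Qed.

Lemma padic_abs_ge0 (x : padic p) : 0 <= padic_abs x.
Proof. by have [->|/padic_abs_gt0/ltW//] := eqVneq x 0; rewrite padic_abs0. Qed.

Lemma padic_abs_eq0 (x : padic p) : padic_abs x = 0 -> x = 0.
Proof.
by move=> x0; apply/eqP/negPn/negP => /padic_abs_gt0; rewrite x0 ltxx.
Qed.

Lemma padic_absM (x y : padic p) : padic_abs (x * y) = padic_abs x * padic_abs y.
Proof.
have [->|x0] := eqVneq x 0; first by rewrite mul0r padic_abs0 mul0r.
have [->|y0] := eqVneq y 0; first by rewrite mulr0 padic_abs0 mulr0.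
have := mulf_neq0 x0 y0; move: x0 y0.
rewrite -(padic_seqK x) -(padic_seqK y) -padic_of_seqM.
move=> /padic_abs_eventually[a ha] /padic_abs_eventually[b hb].
move=> /padic_abs_eventually[c hc].
pose n := maxn a (maxn b c).
rewrite -(ha n) ?leq_maxl// -(hb n) ?leq_max ?leqnn ?orbT//.
by rewrite -(hc n) ?leq_max ?leqnn ?orbT// -rat_padic_absM.
Qed.

Lemma padic_absN (x : padic p) : padic_abs (- x) = padic_abs x.
Proof.
have [->|x0] := eqVneq x 0; first by rewrite oppr0.
have : - x != 0 by rewrite oppr_eq0.
move: x0; rewrite -(padic_seqK x) -padic_of_seqN.
move=> /padic_abs_eventually[a ha] /padic_abs_eventually[b hb].
rewrite -(ha (maxn a b)) ?leq_maxl// -(hb (maxn a b)) ?leq_maxr//.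
exact: rat_padic_absN.
Qed.

Lemma padic_absD (x y : padic p) :
  padic_abs (x + y) <= Num.max (padic_abs x) (padic_abs y).
Proof.
have [->|x0] := eqVneq x 0; first by rewrite add0r le_max lexx orbT.
have [->|y0] := eqVneq y 0; first by rewrite addr0 le_max lexx.
have [->|] := eqVneq (x + y) 0; first by rewrite padic_abs0 le_max padic_abs_ge0.
move: x0 y0; rewrite -(padic_seqK x) -(padic_seqK y) -padic_of_seqD.
move=> /padic_abs_eventually[a ha] /padic_abs_eventually[b hb].
move=> /padic_abs_eventually[c hc].
pose n := maxn a (maxn b c).
rewrite -(ha n) ?leq_maxl// -(hb n) ?leq_max ?leqnn ?orbT//.
rewrite -(hc n) ?leq_max ?leqnn ?orbT//; exact: rat_padic_absD.
Qed.

Definition padic_dist (x y : padic p) : rat := padic_abs (x - y).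

Lemma padic_distxx x : padic_dist x x = 0.
Proof. by rewrite /padic_dist subrr padic_abs0. Qed.

Lemma padic_dist_positivity x y : padic_dist x y = 0 -> x = y.
Proof. by move=> /padic_abs_eq0 /eqP; rewrite subr_eq0 => /eqP. Qed.

Lemma padic_dist_sym x y : padic_dist x y = padic_dist y x.
Proof. by rewrite /padic_dist -padic_absN opprB. Qed.

Lemma padic_dist_triangle y x z :
  padic_dist x z <= padic_dist x y + padic_dist y z.
Proof.
rewrite /padic_dist -(subrKA y); apply: (le_trans (padic_absD _ _)).
by rewrite ge_max lerDl lerDr !padic_abs_ge0.
Qed.

HB.instance Definition _ := @isMetric.Build rat (padic p) padic_dist
  padic_distxx padic_dist_positivity padic_dist_sym padic_dist_triangle.

End PadicField.

Definition padic_space (p d : nat) : Type := 'rV[padic p]_d.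

HB.instance Definition _ (p d : nat) :=
  GRing.Lmodule.copy (padic_space p d) 'rV[padic p]_d.
HB.instance Definition _ (p d : nat) :=
  PseudoMetric.copy (padic_space p d) 'rV[padic p]_d.
HB.instance Definition _ (p d : nat) :=
  Pointed.copy (padic_space p d) 'rV[padic p]_d.
HB.instance Definition _ (p d : nat) := Measurable.copy (padic_space p d)
  (g_sigma_algebraType (@open 'rV[padic p]_d)).

Section PadicSpace.
Variables (p d : nat).
Local Notation V := (padic_space p d).

Definition padic_norm (x : V) : rat :=
  \big[Num.max/0]_(j < d) padic_abs (x ord0 j).

Lemma padic_norm_lt (x : V) (e : rat) : 0 < e ->
  (padic_norm x < e) = [forall j, padic_abs (x ord0 j) < e].
Proof.
move=> e0; apply/idP/forallP => [h j|h]; last exact/bigmax_ltP.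
by move/bigmax_ltP: h => -[_ h]; exact: h.
Qed.

Lemma padic_space_ballE (x : V) (e : rat) : 0 < e ->
  ball x e = [set y | padic_norm (x - y) < e].
Proof.
move=> e0; apply/seteqP; split => y /=.
  move=> [_ h]; rewrite padic_norm_lt//; apply/forallP => j.
  by move: (h ord0 j); rewrite ballEmdist /= !mxE.
rewrite padic_norm_lt// => /forallP h; split=> // i j.
by rewrite (ord1 i) ballEmdist /=; move: (h j); rewrite !mxE.
Qed.

Definition padic_ball (g : int) : set V := [set x | padic_norm x < p%:R ^ g].

Definition padic_integers : set V := [set x | padic_norm x <= 1].

Definition minkowski_sum (A B : set V) : set V :=
  [set a + b | a in A & b in B].

Definition discrete_set (L : set V) : Prop := L `<=` isolated L.

Definition weakly_converges (L_ : nat -> set V) (L : set V) : Prop :=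
  forall (eta : nat) (g : int), exists N, forall n, (N <= n)%N ->
    L_ n `&` padic_ball g `<=` minkowski_sum L (padic_ball (- eta%:Z)) /\
    L `&` padic_ball g `<=` minkowski_sum (L_ n) (padic_ball (- eta%:Z)).

Variable R : realType.

Definition separated_by (delta : R) (L : set V) : Prop :=
  forall x y, L x -> L y -> x != y -> delta <= ratr (padic_norm (x - y)).

Definition uniformly_discrete (L : set V) : Prop :=
  exists2 delta : R, 0 < delta & separated_by delta L.

(* +oo when L has at most one point. *)
Definition separation_constant (L : set V) : \bar R :=
  ereal_sup [set delta%:E | delta in [set delta | 0 < delta /\
                                                 separated_by delta L]].

(* These conditions determine mu among measures on the Borel sets; finiteness
   on compact sets follows from the normalization. *)
Definition normalized_haar (mu : {measure set V -> \bar R}) : Prop :=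
  (forall (a : V) (A : set V), measurable A ->
     mu [set a + x | x in A] = mu A) /\
  mu padic_integers = 1%E.

Definition tiling_pair (mu : {measure set V -> \bar R}) (f : V -> R)
    (L : set V) : Prop :=
  discrete_set L /\
  {ae mu, forall x, \esum_(l in L) (f (x - l))%:E = 1%E}.

End PadicSpace.

(* Main.v *)
(* Let B be the ball of radius p^g <= min(1, delta).  If distinct points of A
   lie in distinct cosets of B, then translation invariance turns
   \int_(c + B) \sum_(l in A) f(x - l) dx into the integral of f over the
   disjoint union of the cosets (c - l) + B, l in A.  By the ultrametric
   inequality these unions for L_ n agree with the one for L on any given
   bounded set for n large, so dominated convergence gives
   \int_(c + B) \sum_(l in L) f(x - l) dx = mu (c + B).  The same holds for
   smaller balls, and small cosets form a pi-system generating the Borel sets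
   (rational points are dense), hence \sum_(l in L) f(x - l) is the density of
   mu with respect to itself. *)
From HB Require Import structures.
Require Import Defs.
From mathcomp Require Import all_boot all_order all_algebra.
From mathcomp Require Import all_classical all_reals all_analysis.
From mathcomp Require Import measurable_realfun measurable_fun_approximation.

Import Order.TTheory GRing.Theory Num.Theory.

Local Open Scope classical_set_scope.
Local Open Scope ring_scope.

(** * Sums over countable index sets under the integral sign, and densities *)

Section IntegralGenerals.
Set Implicit Arguments.
Unset Strict Implicit.
Local Open Scope ereal_scope.

(** The enumeration is chosen before the family [a], so that one series serves for all points at
    once when [a] depends on a point. Indices outside [P] contribute 0, which treats finite and
    infinite [A] alike. *)
Lemma countable_esumE (R : realType) (I : pointedType) (A : set I) :
  countable A -> exists (P : set nat) (u : nat -> I), set_bij P A u /\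
    forall a : I -> \bar R, (forall i, 0 <= a i) ->
      \esum_(i in A) a i = \sum_(k <oo) if k \in P then a (u k) else 0.
Proof.
move=> /countable_bijP[P]; rewrite card_eq_sym => /card_set_bijP[u uPA].
exists P, u; split=> // a a0.
rewrite (reindex_esum _ _ _ _ uPA) esum_mkcond nneseries_esumT// => k.
by case: ifP.
Qed.

Context d (T : measurableType d) (R : realType).
Variable mu : {measure set T -> \bar R}.

Lemma measurable_fun_esum (I : pointedType) (A : set I) (F : I -> T -> \bar R) :
  countable A -> (forall i, measurable_fun setT (F i)) ->
  (forall i x, 0 <= F i x) ->
  measurable_fun setT (fun x => \esum_(i in A) F i x).
Proof.
move=> /(@countable_esumE R)[P [u [_ AE]]] mF F0.
have -> := funext (fun x => AE (F ^~ x) (F0 ^~ x)).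
apply: (@ge0_emeasurable_sum _ _ _ _
  (fun k x => if k \in P then F (u k) x else 0) xpredT).
- by move=> k x _ _; case: ifP.
- by move=> k _; case: (k \in P).
Qed.

Lemma ge0_integral_esum (I : pointedType) (A : set I) (F : I -> T -> \bar R)
    (D : set T) :
  countable A -> measurable D -> (forall i, measurable_fun setT (F i)) ->
  (forall i x, 0 <= F i x) ->
  \int[mu]_(x in D) (\esum_(i in A) F i x) =
  \esum_(i in A) \int[mu]_(x in D) F i x.
Proof.
move=> /(@countable_esumE R)[P [u [_ AE]]] mD mF F0.
under eq_integral => x _ do rewrite (AE (F ^~ x) (F0 ^~ x)).
rewrite AE; last by move=> i; exact: integral_ge0.
rewrite integral_nneseries//; last 2 first.
- by move=> k; case: (k \in P) => //; exact: measurable_funTS.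
- by move=> k x _; case: ifP.
by apply: eq_eseriesr => k _; case: (k \in P) => //; rewrite integral0.
Qed.

Lemma ge0_integral_bigcup_esum (I : pointedType) (A : set I) (D : I -> set T)
    (f : T -> \bar R) :
  countable A -> (forall i, measurable (D i)) -> trivIset A D ->
  measurable_fun setT f -> (forall x, 0 <= f x) ->
  \int[mu]_(x in \bigcup_(i in A) D i) f x =
  \esum_(i in A) \int[mu]_(x in D i) f x.
Proof.
move=> /(@countable_esumE R)[P [u [uPA AE]]] mD tD mf f0.
rewrite AE; last by move=> i; exact: integral_ge0.
have [uA uI uS] := uPA.
(* Padding with [set0] outside [P] gives a sequence of sets; it stays disjoint because [u] is
   injective on [P]. *)
have -> : \bigcup_(i in A) D i = \bigcup_k if k \in P then D (u k) else set0.
  apply/seteqP; split => [x [i Ai Dx]|x [k _]].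
    by have [k Pk ki] := uS _ Ai; exists k => //; rewrite mem_set// ki.
  by case: ifPn => // /set_mem Pk Dx; exists (u k) => //; exact: uA.
rewrite ge0_integral_bigcup//.
- by apply: eq_eseriesr => k _; case: ifP => // _; rewrite integral_set0.
- by move=> k; case: ifP.
- exact: measurable_funTS.
- apply/trivIsetP => j k _ _ jk.
  case: ifPn; rewrite ?set0I// => /set_mem Pj.
  case: ifPn; rewrite ?setI0// => /set_mem Pk.
  apply/eqP/negPn/negP => /set0P[x [xj xk]]; move/eqP: jk; apply.
  apply: uI; rewrite ?inE//.
  by apply: (tD _ _ (uA _ Pj) (uA _ Pk)); exists x.
Qed.

Section Density.
Variables (h : T -> \bar R).
Hypotheses (mh : measurable_fun setT h) (h0 : forall x, 0 <= h x).

Let nu (A : set T) := \int[mu]_(x in A) h x.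

Let nu0 : nu set0 = 0. Proof. exact: integral_set0. Qed.

Let nu_ge0 A : 0 <= nu A. Proof. exact: integral_ge0. Qed.

Let nu_sigma_additive : semi_sigma_additive nu.
Proof.
move=> F mF tF _; rewrite /nu ge0_integral_bigcup//;
  last exact: measurable_funTS.
by apply: is_cvg_ereal_nneg_natsum => k _; exact: integral_ge0.
Qed.

HB.instance Definition _ := isMeasure.Build _ _ _ nu
  nu0 nu_ge0 nu_sigma_additive.

(** The measure [nu] with density [h] agrees with [mu] on the pi-system [G], hence on all measurable
    sets, by uniqueness of measures along the cover [g]. On each [g k] the constant 1 is integrable,
    so equal integrals over all measurable subsets force [h = 1] almost everywhere; countably many
    null sets are then united. *)
Lemma ge0_ae_eq1_pi_system (G : set (set T)) (g : (set T)^nat) :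
  measurable = <<s G >> -> setI_closed G -> (forall i, G (g i)) ->
  \bigcup_k g k = setT -> (forall k, mu (g k) < +oo) ->
  (forall A, G A -> \int[mu]_(x in A) h x = mu A) ->
  {ae mu, forall x, h x = 1}.
Proof.
move=> mG GI Gg gT goo hG.
have nuE A : measurable A -> \int[mu]_(x in A) h x = mu A.
  move=> mA; apply/esym.
  apply: (@measure_unique _ _ _ G g mG GI Gg gT mu nu _ goo _ mA) => B GB.
  exact/esym/hG.
have mg k : measurable (g k) by rewrite mG; apply: sub_sigma_algebra.
have /ae_foralln : forall k, {ae mu, forall x, g k x -> 1 = h x}.
  move=> k; apply: integral_ae_eq => //.
  - apply/integrableP; split; first exact: measurable_cst.
    by rewrite abse1 integral_cst// mul1e.
  - exact: measurable_funTS.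
  - by move=> E _ mE; rewrite nuE// integral_cst// mul1e.
apply: filterS => x hx.
have [k _ gk] : (\bigcup_k g k) x by rewrite gT.
exact/esym/(hx k).
Qed.

End Density.
End IntegralGenerals.

(** * Ultrametric geometry of balls, and generators of the Borel sets *)

Section PadicGeometry.
Set Implicit Arguments.
Unset Strict Implicit.
Variables (p d : nat).
Hypothesis p_prime : prime p.
Local Notation V := (padic_space p d).
Implicit Types (x y z c : V) (g h : int) (e : rat).

Lemma ppow_gt0 {K : numFieldType} g : 0 < p%:R ^ g :> K.
Proof. by rewrite exprz_gt0// ltr0n prime_gt0. Qed.

Lemma ler_ppow {K : realFieldType} g h : (p%:R ^ g <= p%:R ^ h :> K) = (g <= h).
Proof. by rewrite ler_eXz2l// ltr1n prime_gt1. Qed.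

Lemma ppow_small {K : archiRealFieldType} (e : K) :
  0 < e -> exists k : nat, p%:R ^ (- k%:Z) < e.
Proof.
(* With [k] a natural number above [e^-1], the claim follows from [k < p ^ k]. *)
move=> e0; exists (Num.bound e^-1).
rewrite -exprz_inv -exprnP exprVn -ltf_pV2 ?posrE
  ?invr_gt0 ?exprn_gt0 ?ltr0n ?prime_gt0//.
rewrite invrK; apply: (lt_trans (archi_boundP _)).
  by rewrite invr_ge0 ltW.
by rewrite -natrX ltr_nat ltn_expl// prime_gt1.
Qed.

Lemma padic_norm0 : padic_norm (0 : V) = 0.
Proof.
rewrite /padic_norm.
by apply: big1_idem => [|j _]; rewrite ?maxxx// mxE padic_abs0.
Qed.

Lemma padic_normN x : padic_norm (- x) = padic_norm x.
Proof. by apply: eq_bigr => j _; rewrite mxE padic_absN. Qed.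

Lemma padic_normD_lt x y e : 0 < e ->
  padic_norm x < e -> padic_norm y < e -> padic_norm (x + y) < e.
Proof.
move=> e0; rewrite !(padic_norm_lt _ e0) => /forallP hx /forallP hy.
apply/forallP => j; rewrite mxE; apply: (le_lt_trans (padic_absD _ _)).
by rewrite gt_max hx hy.
Qed.

Lemma padic_norm_gt0 x : x != 0 -> 0 < padic_norm x.
Proof.
apply: contra_neqT => h; apply/rowP => j; rewrite mxE.
apply: padic_abs_eq0; apply/eqP; rewrite eq_le padic_abs_ge0 andbT.
rewrite (le_trans (le_bigmax 0 (fun i => padic_abs (x ord0 i)) j))//.
by rewrite leNgt.
Qed.

Lemma padic_ballD g x y : padic_ball g x -> padic_ball g y ->
  padic_ball g (x + y).
Proof. by apply: padic_normD_lt; exact: ppow_gt0. Qed.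

Lemma padic_ballN g x : padic_ball g (- x) <-> padic_ball g x.
Proof. by rewrite /padic_ball /= padic_normN. Qed.

Lemma padic_ballB g x y : padic_ball g x -> padic_ball g y ->
  padic_ball g (x - y).
Proof. by move=> hx hy; apply: padic_ballD => //; apply/padic_ballN. Qed.

Lemma padic_ball_sym g x y : padic_ball g (x - y) <-> padic_ball g (y - x).
Proof. by rewrite -padic_ballN opprB. Qed.

Lemma padic_ball_trans g x y z :
  padic_ball g (x - y) -> padic_ball g (y - z) -> padic_ball g (x - z).
Proof.
by move=> hx hy; rewrite -[x - z](subrKA y); exact: (padic_ballD hx hy).
Qed.

Lemma padic_ball0 g : padic_ball g (0 : V).
Proof. by rewrite /padic_ball /= padic_norm0 ppow_gt0. Qed.

Lemma padic_ballW g h : g <= h -> padic_ball g `<=` (padic_ball h : set V).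
Proof. by move=> gh x /lt_le_trans; apply; rewrite ler_ppow. Qed.

Lemma padic_ball_exhaust x : exists k : nat, padic_ball k x.
Proof.
have [->|x0] := eqVneq x 0; first by exists 0%N; exact: padic_ball0.
have := padic_norm_gt0 x0; rewrite -invr_gt0 => /ppow_small[k].
rewrite -invr_expz ltf_pV2 ?posrE ?padic_norm_gt0 ?ppow_gt0// => kx.
by exists k.
Qed.

(** A ball around 0 is a subgroup by the ultrametric inequality, so a ball around [c] is one of its
    cosets, and any of its points may serve as [c]. *)
Definition padic_coset c g : set V := [set x | padic_ball g (x - c)].

Lemma padic_cosetE c g : padic_coset c g = ball c (p%:R ^ g : rat).
Proof.
rewrite (padic_space_ballE c (ppow_gt0 g)).
by apply/seteqP; split => x /padic_ball_sym.
Qed.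

Lemma padic_coset_eq c c' g : padic_coset c g c' ->
  padic_coset c g = padic_coset c' g.
Proof.
move=> cc'.
have c'c : padic_ball g (c - c') by exact: (iffLR (padic_ball_sym _ _ _) cc').
apply/seteqP; split => x h; first exact: (padic_ball_trans h c'c).
exact: (padic_ball_trans h cc').
Qed.

Lemma nbhs_padic_coset c g : nbhs c (padic_coset c g).
Proof. by rewrite padic_cosetE; apply: nbhsx_ballx; exact: ppow_gt0. Qed.

Lemma open_padic_coset c g : open (padic_coset c g).
Proof.
rewrite openE => x cx; rewrite (padic_coset_eq cx).
exact: nbhs_padic_coset.
Qed.

Lemma nbhs_padic_cosetP c (A : set V) : nbhs c A ->
  forall g, exists2 h, h <= g & padic_coset c h `<=` A.
Proof.
move=> /nbhs_ballP[e /= e0 eA] g.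
have [k ke] := @ppow_small rat e e0.
exists (Num.min g (- k%:Z)); first by rewrite ge_min lexx.
apply: subset_trans eA => x; rewrite padic_cosetE; apply: le_ball.
apply: le_trans (ltW ke).
by rewrite ler_ppow ge_min lexx orbT.
Qed.

Lemma measurable_padic_coset c g : measurable (padic_coset c g).
Proof. by apply: sub_sigma_algebra; exact: open_padic_coset. Qed.

Lemma const_padic_cauchy (q : rat) : (fun=> q) \in padic_cauchy p.
Proof.
by apply/asboolP => e e0; exists 0%N => m n _ _; rewrite subrr rat_padic_abs0.
Qed.

Definition padic_of_rat (q : rat) : padic p :=
  padic_of_seq (CauchySeq (const_padic_cauchy q)).

(** The point [q] is a late term of a Cauchy sequence representing [x]. The absolute value of a
    nonzero class is attained by the terms from some index on, so the strict Cauchy bound passes to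
    the class. *)
Lemma padic_of_rat_dense (x : padic p) e : 0 < e ->
  exists q, padic_abs (x - padic_of_rat q) < e.
Proof.
move=> e0; have [n0 h] := asboolP _ (valP (padic_seq x)) _ e0.
exists (padic_seq x n0); set y := _ - _.
have [->|] := eqVneq y 0; first by rewrite padic_abs0.
rewrite {}/y -{1 3}(padic_seqK x) -padic_of_seqN -padic_of_seqD.
move=> /padic_abs_eventually[n1 h1]; rewrite -(h1 (maxn n0 n1)) ?leq_maxr//.
by apply: h; rewrite ?leq_maxl.
Qed.

(** Numbers that encode no rational vector are sent to 0, which makes this a total sequence. *)
Definition padic_rat_point (n : nat) : V :=
  if unpickle n is Some q then map_mx padic_of_rat (q : 'rV[rat]_d) else 0.

Lemma padic_rat_point_dense x g : exists n, padic_coset (padic_rat_point n) g x.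
Proof.
have /choice[q hq] (j : 'I_d) := padic_of_rat_dense (x ord0 j) (ppow_gt0 g).
exists (pickle (\row_j q j)); rewrite /padic_coset /padic_rat_point pickleK.
rewrite /padic_ball /= (padic_norm_lt _ (ppow_gt0 g)).
by apply/forallP => j; rewrite !mxE.
Qed.

(** The empty set is included for the sake of closure under intersection: two cosets are either
    disjoint or nested. *)
Definition small_cosets g0 : set (set V) :=
  [set A | A = set0 \/ exists c g, g <= g0 /\ A = padic_coset c g].

Lemma small_cosets_setI g0 : setI_closed (small_cosets g0).
Proof.
move=> A B [->|[c [g [gg0 ->]]]]; first by rewrite set0I; left.
move=> [->|[c' [g' [gg0' ->]]]]; first by rewrite setI0; left.
have [->|/set0P[x [xc xc']]] :=
    eqVneq (padic_coset c g `&` padic_coset c' g') set0.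
  by left.
rewrite (padic_coset_eq xc) (padic_coset_eq xc'); right.
have [gg'|/ltW gg'] := leP g g'.
- exists x, g; split=> //; apply: setIidl => y; exact: padic_ballW.
- exists x, g'; split=> //; apply: setIidr => y; exact: padic_ballW.
Qed.

(** An open set is the union of the small cosets with rational centre that it contains, and these
    are countably many. *)
Lemma measurable_small_cosets g0 : @measurable _ V = <<s small_cosets g0 >>.
Proof.
apply/seteqP; split.
- apply: smallest_sub; first exact: smallest_sigma_algebra.
  move=> O oO.
  pose F (n k : nat) :=
    padic_coset (padic_rat_point n) (Num.min g0 (- k%:Z)).
  have -> : O = \bigcup_n \bigcup_k if `[<F n k `<=` O>] then F n k else set0.
    apply/seteqP; split => [x Ox|x [n _ [k _]]]; last first.
      by case: asboolP => // FO /FO.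
    (* The bound [Num.min g0 0] ensures that [h] is [Num.min g0 (- k%:Z)] for [k] the absolute value
       of [h], as in the definition of [F]. *)
    have [h hg hO] :=
      nbhs_padic_cosetP (open_nbhs_nbhs (conj oO Ox)) (Num.min g0 0).
    have [n nx] := padic_rat_point_dense x h.
    have [/(le_trans hg)] : Num.min g0 0 <= 0 by rewrite ge_min lexx orbT.
    move: hg; rewrite le_min => /andP[hg0 _] h0.
    have hE : Num.min g0 (- `|h|%N%:Z) = h.
      by rewrite abszE ler0_norm// opprK min_r.
    have FE : F n `|h|%N = padic_coset x h.
      by rewrite /F hE (padic_coset_eq nx).
    exists n; [exact: I|exists `|h|%N; [exact: I|]].
    rewrite FE (asboolT hO).
    by rewrite /padic_coset /= subrr; exact: padic_ball0.
  apply: sigma_algebra_bigcup => n; apply: sigma_algebra_bigcup => k.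
  case: asboolP => _; last exact: sigma_algebra0.
  apply: sub_sigma_algebra; right.
  exists (padic_rat_point n), (Num.min g0 (- k%:Z)).
  by rewrite ge_min lexx.
- apply: smallest_sub; first exact: sigma_algebra_measurable.
  by move=> A [->|[c [g [_ ->]]]] //; exact: measurable_padic_coset.
Qed.

Lemma measurable_padic_translation c : measurable_fun setT (fun x : V => x - c).
Proof.
apply: (@measurability _ _ _ _ _ _ (small_cosets 0)).
  exact: measurable_small_cosets.
move=> _ [A sA <-]; rewrite setTI.
case: sA => [->|[c' [g [_ ->]]]]; first by rewrite preimage_set0.
have -> : (fun x : V => x - c) @^-1` padic_coset c' g = padic_coset (c' + c) g.
  by apply/seteqP; split => x; rewrite /padic_coset /= opprD (addrAC x) !addrA.
exact: measurable_padic_coset.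
Qed.

(** Sending each point to a rational point in its coset is injective on [A]. *)
Lemma separated_countable (A : set V) g :
  (forall x y, A x -> A y -> padic_ball g (x - y) -> x = y) -> countable A.
Proof.
move=> sA; have /choice[u hu] := fun x => padic_rat_point_dense x g.
apply/countable_injP; exists u => x y /set_mem Ax /set_mem Ay uxy.
apply: sA => //; apply: (padic_ball_trans (hu x)).
by apply/padic_ball_sym; rewrite uxy; exact: hu.
Qed.

End PadicGeometry.

(** * Separation and coset unions under weak convergence *)

Section WeakLimits.
Set Implicit Arguments.
Unset Strict Implicit.
Variables (p d : nat).
Hypothesis p_prime : prime p.
Local Notation V := (padic_space p d).
Implicit Types (x y z c : V) (g h : int) (A : set V).

(** Stand-in for a real separation constant: distinct points lie in distinct cosets of the ball of
    radius [p ^ g]. *)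
Definition coset_separated g A :=
  forall x y, A x -> A y -> padic_ball g (x - y) -> x = y.

Lemma coset_separatedW g h A : h <= g ->
  coset_separated g A -> coset_separated h A.
Proof.
by move=> hg sA x y Ax Ay xy; apply: sA => //;
  exact: (padic_ballW p_prime hg xy).
Qed.

Lemma separation_constant_coset (R : realType) (delta : R) g A :
  p%:R ^ g <= delta -> (delta%:E <= separation_constant R A)%E ->
  coset_separated g A.
Proof.
move=> gdelta dA x y Ax Ay xy; apply/eqP/negPn/negP => xNy.
have : (separation_constant R A <= (ratr (padic_norm (x - y)))%:E)%E.
  by apply: ge_ereal_sup => _ [e [_ eA] <-]; rewrite lee_fin; exact: eA.
move=> /(le_trans dA); rewrite lee_fin leNgt => /negP; apply.
apply: lt_le_trans gdelta.
have <- : ratr (p%:R ^ g) = p%:R ^ g :> R by rewrite fmorphXz rmorph_nat.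
by rewrite ltr_rat.
Qed.

Lemma discrete_coset_separated g A : coset_separated g A -> discrete_set A.
Proof.
move=> sA x Ax; split; first by rewrite inE.
exists (padic_coset x g); first exact: nbhs_padic_coset.
apply/seteqP; split => [y [yx Ay]|_ ->]; first exact: sA.
split=> [|//]; rewrite /padic_coset /= subrr; exact: padic_ball0.
Qed.

Variables (L_ : nat -> set V) (L : set V).
Hypothesis L_weak : weakly_converges L_ L.

(** Let distinct [x], [y] in [L] share a coset. Both are approximated by points [u], [u'] of a
    single [L_ N]. These share a coset too, hence coincide, which puts [x] closer to [y] than it
    is. *)
Lemma weak_limit_coset_separated g :
  (forall n, coset_separated g (L_ n)) -> coset_separated g L.
Proof.
move=> sL x y Lx Ly xy; apply/eqP/negPn/negP => xNy.
have xy0 : 0 < padic_norm (x - y) by apply: padic_norm_gt0; rewrite subr_eq0.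
have [k kxy] := ppow_small p_prime xy0.
(* The part [k] makes the approximation finer than the distance from [x] to [y]; the part [|g|]
   keeps the errors inside the ball of radius [p ^ g]. *)
pose eta := maxn k `|g|%N.
have etag : - eta%:Z <= g.
  rewrite lerNl (@le_trans _ _ `|g|%N%:Z)//.
    by rewrite abszE -normrN ler_norm.
  by rewrite lez_nat leq_maxr.
have [a xa] := padic_ball_exhaust p_prime x.
have [b yb] := padic_ball_exhaust p_prime y.
have [N /(_ N (leqnn N))[_ LN]] := L_weak eta (maxn a b).
have [|u Lu [v vB uvx]] := LN x.
  by split => //; apply: (padic_ballW p_prime _ xa); rewrite lez_nat leq_maxl.
have [|u' Lu' [v' vB' uvy]] := LN y.
  by split => //; apply: (padic_ballW p_prime _ yb); rewrite lez_nat leq_maxr.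
have xyE : x - y = (u - u') + (v - v') by rewrite -uvx -uvy opprD addrACA.
have vvB := padic_ballB p_prime vB vB'.
have uu : u = u'.
  apply: (sL N _ _ Lu Lu').
  have -> : u - u' = (x - y) - (v - v') by rewrite xyE addrK.
  exact: (padic_ballB p_prime xy (padic_ballW p_prime etag vvB)).
move: xyE; rewrite uu subrr add0r => xyE.
have : padic_norm (x - y) < p%:R ^ (- eta%:Z) by rewrite xyE.
rewrite ltNge => /negP; apply; apply: le_trans (ltW kxy).
by rewrite ler_ppow// lerN2 lez_nat leq_maxl.
Qed.

(** With [B] the ball of radius [p ^ g], this is [c + B - A]: the values of [x - l] for [x] in
    [c + B] and [l] in [A]. *)
Definition reflected_cosets c g A : set V :=
  \bigcup_(l in A) padic_coset (c - l) g.

(** Whether [x] belongs depends only on the points [l] in the bounded set [c - x + B], and only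
    through their cosets modulo [B]. Weak convergence matches these cosets for [L_ n] and [L] once
    [n] is large, depending on [x]. *)
Lemma reflected_cosets_stable c g x : g <= 0 ->
  exists N, forall n, (N <= n)%N ->
  reflected_cosets c g (L_ n) x <-> reflected_cosets c g L x.
Proof.
(* Weak convergence admits only radii [p ^ (- eta)] with [eta] natural; here [eta] is [|g|]. *)
move=> g0; have gE : - `|g|%N%:Z = g by rewrite abszE ler0_norm// opprK.
have [k ck] := padic_ball_exhaust p_prime (c - x).
have near_l l : padic_coset (c - l) g x -> padic_ball k l.
  move=> xl; have -> : l = (c - x) + (x - (c - l)).
    by rewrite subrKA opprB addrC subrK.
  apply: (padic_ballD p_prime ck); apply: (padic_ballW p_prime _ xl).
  exact: le_trans g0 _.
have move_l l m v : m + v = l -> padic_ball g v ->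
    padic_coset (c - l) g x -> padic_coset (c - m) g x.
  move=> <- vg xl; rewrite /padic_coset /=.
  have -> : x - (c - m) = (x - (c - (m + v))) - v.
    by rewrite !opprD !opprK !addrA addrK.
  exact: (padic_ballB p_prime xl vg).
have [N LN] := L_weak `|g|%N k; exists N => n /LN; rewrite gE => -[LnL LLn].
split=> -[l Ll xl].
- have [m Lm [v vg mvl]] := LnL _ (conj Ll (near_l _ xl)).
  exists m; [exact: Lm|exact: move_l mvl vg xl].
- have [m Lm [v vg mvl]] := LLn _ (conj Ll (near_l _ xl)).
  exists m; [exact: Lm|exact: move_l mvl vg xl].
Qed.

End WeakLimits.

(** * Haar measure and passage of the tiling identity to the limit *)

Section Tiling.
Set Implicit Arguments.
Unset Strict Implicit.
Variables (R : realType) (p d : nat).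
Hypothesis p_prime : prime p.
Local Notation V := (padic_space p d).
Implicit Types (x y z c : V) (g h : int).
Variable mu : {measure set V -> \bar R}.
Hypothesis mu_haar : normalized_haar mu.
Local Open Scope ereal_scope.

(** Invariance in the form that pushforward measures require, with preimages in place of images. *)
Lemma haar_preimage_translation c (A : set V) : measurable A ->
  mu ((fun x => x - c)%R @^-1` A) = mu A.
Proof.
move=> mA; rewrite -[RHS](mu_haar.1 c A mA); congr (mu _).
apply/seteqP; split => [x Ax|_ [x Ax <-]] /=; last by rewrite (addrC c) addrK.
by exists (x - c)%R => //; rewrite addrC subrK.
Qed.

Lemma measurable_padic_integers : measurable (@padic_integers p d).
Proof.
apply: sub_sigma_algebra; rewrite openE => x x1.
apply: filterS (nbhs_padic_coset p_prime x 0) => y yx.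
(* As [padic_normD_lt] concerns strict inequalities, the bound 1 is relaxed to [1 + e] for every
   positive [e]. *)
apply/ler_addgt0Pr => e e0; apply: ltW; rewrite -[y](subrK x).
have lt1e : (1 < 1 + e)%R by rewrite ltrDl.
apply: padic_normD_lt; first exact: lt_trans lt1e.
- exact: lt_trans yx lt1e.
- exact: le_lt_trans x1 lt1e.
Qed.

(** Translated to the origin, the coset lies in [padic_integers], which has measure 1. *)
Lemma haar_coset_fin c g : (g <= 0)%R -> mu (padic_coset c g) < +oo.
Proof.
move=> g0.
have -> : padic_coset c g = (fun x => x - c)%R @^-1` (padic_coset (0%R : V) g).
  by apply/seteqP; split => x; rewrite /padic_coset /= subr0.
have mB := measurable_padic_coset p_prime (0%R : V) g.
rewrite haar_preimage_translation//.
apply: (@le_lt_trans _ _ (mu (@padic_integers p d))); last first.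
  by rewrite mu_haar.2 ltry.
apply: le_measure; rewrite ?inE//; first exact: measurable_padic_integers.
move=> x; rewrite /padic_coset /= subr0 => xg.
by apply: ltW; exact: (padic_ballW p_prime g0 xg).
Qed.

Lemma haar_integral_translation c (D : set V) (f : V -> \bar R) :
  measurable D ->
  measurable_fun setT f -> (forall x, 0 <= f x) ->
  \int[mu]_(x in (fun x => x - c)%R @^-1` D) f (x - c)%R =
  \int[mu]_(x in D) f x.
Proof.
move=> mD mf f0.
have mc := measurable_padic_translation p_prime c.
rewrite -(ge0_integral_pushforward mc mu mD (measurable_funTS mf))//.
by apply: eq_measure_integral => A mA _; exact: haar_preimage_translation.
Qed.

Variable f : V -> R.
Hypothesis f_int : mu.-integrable setT (EFin \o f).
Hypothesis f_ge0 : forall x, (0 <= f x)%R.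

Let mf : measurable_fun setT (EFin \o f).
Proof. exact: measurable_int f_int. Qed.

Let f0 x : 0 <= (EFin \o f) x. Proof. by rewrite lee_fin. Qed.

Lemma measurable_translate l :
  measurable_fun setT (fun x : V => (f (x - l)%R)%:E).
Proof.
exact: (measurableT_comp mf (measurable_padic_translation p_prime l)).
Qed.

Lemma measurable_reflected_cosets c g A :
  measurable (reflected_cosets c g A).
Proof.
apply: sub_sigma_algebra; apply: bigcup_open => l _.
exact: open_padic_coset.
Qed.

(** Sum and integral are exchanged, the term of [l] is translated by [l], and the resulting domains,
    disjoint by separation, are reassembled. *)
Lemma integral_coset_esum c g A : coset_separated g A ->
  \int[mu]_(x in padic_coset c g) (\esum_(l in A) (f (x - l)%R)%:E) =
  \int[mu]_(x in reflected_cosets c g A) (EFin \o f) x.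
Proof.
move=> sA; have cA := separated_countable p_prime sA.
rewrite ge0_integral_esum//; last 2 first.
- exact: measurable_translate.
- by move=> l x; exact: f0.
- rewrite ge0_integral_bigcup_esum//.
  - apply: eq_esum => l _.
    have -> : padic_coset c g =
        (fun x => x - l)%R @^-1` padic_coset (c - l)%R g.
      by apply/seteqP; split => x; rewrite /padic_coset /= opprB subrKA.
    apply: haar_integral_translation => //.
    exact: measurable_padic_coset.
  - by move=> l; exact: measurable_padic_coset.
  - move=> l m Al Am [x [xl xm]]; apply: (sA _ _ Al Am).
    (* A common point [x] of the cosets of [c - l] and [c - m] places [l - m] in the ball. *)
    have -> : (l - m = (x - (c - l)) - (x - (c - m)))%R.
      by rewrite !opprB [RHS]addrC subrKA [RHS]addrC subrKA.
    exact: (@padic_ballB _ _ p_prime g _ _ xl xm).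
- exact: measurable_padic_coset.
Qed.

(** The right side does not involve [A], so along [L_ n] these integrals form a constant
    sequence. *)
Lemma tiling_integral_coset c g A : coset_separated g A -> tiling_pair mu f A ->
  \int[mu]_(x in reflected_cosets c g A) (EFin \o f) x = mu (padic_coset c g).
Proof.
move=> sA [_ fA]; rewrite -integral_coset_esum//.
have mB := measurable_padic_coset p_prime c g.
transitivity (\int[mu]_(x in padic_coset c g) (cst 1 x)).
  apply: ae_eq_integral => //; last by apply: filterS fA => x.
  apply: measurable_funTS; apply: measurable_fun_esum => //.
  - exact: (separated_countable p_prime sA).
  - exact: measurable_translate.
  - by move=> l x; exact: f0.
by rewrite integral_cst// mul1e.
Qed.

Lemma weak_limit_tiling g (L_ : nat -> set V) (L : set V) : (g <= 0)%R ->
  (forall n, coset_separated g (L_ n)) -> weakly_converges L_ L ->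
  (forall n, tiling_pair mu f (L_ n)) -> tiling_pair mu f L.
Proof.
move=> g0 sLn L_weak f_tiles.
have sL := weak_limit_coset_separated p_prime L_weak sLn.
split; first exact: (discrete_coset_separated p_prime sL).
(* All radii below [p ^ g] are treated, since cosets of a single radius do not generate the Borel
   sets. *)
have int_L c h : (h <= g)%R ->
    \int[mu]_(x in padic_coset c h) (\esum_(l in L) (f (x - l)%R)%:E) =
    mu (padic_coset c h).
  move=> hg; have sLh := coset_separatedW p_prime hg sL.
  have sLnh n := coset_separatedW p_prime hg (sLn n).
  rewrite integral_coset_esum//.
  have mU := measurable_reflected_cosets c h L.
  have mUn n := measurable_reflected_cosets c h (L_ n).
  pose fn n := (EFin \o f) \_ (reflected_cosets c h (L_ n)).
  (* The functions are [f] cut off to the coset unions: [f] itself dominates them, and at each point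
     they are eventually constant in [n]. *)
  have [|||||_ _] := @dominated_convergence _ _ _ mu setT measurableT
    fn ((EFin \o f) \_ (reflected_cosets c h L)) (EFin \o f).
  - by move=> n; apply/(measurable_restrictT _ _).1 => //;
       exact: measurable_funTS.
  - by apply/(measurable_restrictT _ _).1 => //; exact: measurable_funTS.
  - apply: aeW => x _; apply: cvg_near_cst.
    have [N LN] := reflected_cosets_stable p_prime L_weak c x (le_trans hg g0).
    near=> n; have Nn : (N <= n)%N by near: n; exact: nbhs_infty_ge.
    rewrite /fn /patch; congr (if _ then _ else _).
    by apply/idP/idP => /set_mem/(LN n Nn) ?; exact: mem_set.
  - exact: f_int.
  - apply: aeW => x n _; rewrite /fn /patch; case: ifP => _; rewrite ?abse0//.
    by rewrite gee0_abs.
  rewrite -integral_mkcond => cvf.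
  apply: (cvg_unique _ cvf) => //=.
  under eq_fun do rewrite -integral_mkcond tiling_integral_coset//.
  exact: cvg_cst.
apply: (@ge0_ae_eq1_pi_system _ _ R mu
  (fun x => \esum_(l in L) (f (x - l)%R)%:E) _ _ (small_cosets g)
  (fun n => padic_coset (padic_rat_point p d n) g)).
- apply: measurable_fun_esum.
  + exact: (separated_countable p_prime sL).
  + exact: measurable_translate.
  + by move=> l x; exact: f0.
- by move=> x; apply: esum_ge0 => l _; exact: f0.
- exact: measurable_small_cosets.
- exact: small_cosets_setI.
- by move=> n; right; exists (padic_rat_point p d n), g.
- by apply/seteqP; split=> // x _;
     have [n nx] := padic_rat_point_dense p_prime x g; exists n.
- by move=> n; exact: haar_coset_fin.
- by move=> A [->|[c [h [hg ->]]]];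
     [rewrite integral_set0 measure0|exact: int_L].
Unshelve. all: end_near.
Qed.

End Tiling.

Theorem theorem1p1 (R : realType) (p d : nat) (p_prime : prime p)
    (d_ge1 : (1 <= d)%N)
    (mu : {measure set (padic_space p d) -> \bar R})
    (mu_haar : normalized_haar mu)
    (delta : R) (delta_gt0 : 0 < delta)
    (L_ : nat -> set (padic_space p d))
    (L_unif : forall n, uniformly_discrete R (L_ n))
    (L_sep : forall n, (delta%:E <= separation_constant R (L_ n))%E)
    (L : set (padic_space p d))
    (L_weak : weakly_converges L_ L)
    (f : padic_space p d -> R)
    (f_int : mu.-integrable setT (EFin \o f))
    (f_ge0 : forall x, 0 <= f x)
    (f_tiles : forall n, tiling_pair mu f (L_ n)) :
  tiling_pair mu f L.
Proof.
(* The exponent [- k%:Z] gives a radius below [delta] and, being nonpositive, at most 1, so that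
   cosets have finite measure. *)
have [k kdelta] := ppow_small p_prime delta_gt0.
apply: (@weak_limit_tiling _ _ _ p_prime mu mu_haar f f_int f_ge0
  (- k%:Z) L_).
- by rewrite oppr_le0.
- by move=> n; exact: separation_constant_coset (ltW kdelta) (L_sep n).
- exact: L_weak.
- exact: f_tiles.
Qed.
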